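(* Let $\mathfrak{G}\subset \mathrm{GL}(2,\mathbb{C})$ be the group (of order $192$) generated by $$T=\frac{1}{\sqrt2}\begin{pmatrix}1&1\\1&-1\end{pmatrix},\qquad D=\begin{pmatrix}1&0\\0&i\end{pmatrix}.$$ Up to equivalence, $\mathfrak{G}$ has exactly $32$ irreducible complex representations: $8$ of dimension one, $12$ of dimension two, $8$ of dimension three, and $4$ of dimension four. The following representations $\rho_1,\dots,\rho_{32}$, given by the images of the generators $T,D$, are well defined and form a complete set of pairwise inequivalent irreducible complex representations of $\mathfrak{G}$. (1) One-dimensional: $(\rho_j(T),\rho_j(D))$ for $j=1,\dots,8$ equals respectively $(1,1)$, $(1,-1)$, $(1,i)$, $(1,-i)$, $(-1,1)$, $(-1,-1)$, $(-1,i)$, $(-1,-i)$. (2) Two-dimensional, $\rho_9,\dots,\rho_{16}$: $\rho_j(T)=\varepsilon T$, $\rho_j(D)=\eta D$, where $(\varepsilon,\eta)$ for $j=9,\dots,16$ equals respectively $(1,1)$, $(1,i)$, $(1,-1)$, $(1,-i)$, $(-1,1)$, $(-1,i)$, $(-1,-1)$, $(-1,-i)$. (3) Two-dimensional, $\rho_{17},\dots,\rho_{20}$: $$\rho_{17}(T)=\frac12\begin{pmatrix}1&3\\1&-1\end{pmatrix},\quad \rho_{17}(D)=\mathrm{diag}(1,-1),$$ and $\rho_{18}=\rho_2\otimes\rho_{17}$, $\rho_{19}=\rho_3\otimes\rho_{17}$, $\rho_{20}=\rho_4\otimes\rho_{17}$. (4) Three-dimensional: $$\rho_{21}(T)=\frac12\begin{pmatrix}1&2&1\\1&0&-1\\1&-2&1\end{pmatrix},\quad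 \rho_{21}(D)=\mathrm{diag}(1,i,-1),$$ and $\rho_{21+k}=\rho_{k+1}\otimes\rho_{21}$ for $k=1,\dots,7$. (5) Four-dimensional: $$\rho_{29}(T)=\frac{1}{2\sqrt2}\begin{pmatrix}1&3&3&1\\1&1&-1&-1\\1&-1&-1&1\\1&-3&3&-1\end{pmatrix},\quad \rho_{29}(D)=\mathrm{diag}(1,i,-1,-i),$$ and $\rho_{30}=\rho_2\otimes\rho_{29}$, $\rho_{31}=\rho_3\otimes\rho_{29}$, $\rho_{32}=\rho_4\otimes\rho_{29}$.
   Context: For a one-dimensional representation $\chi$ and a matrix representation $\rho$ of $\mathfrak{G}$, $\chi\otimes\rho$ denotes the matrix representation $g\mapsto \chi(g)\rho(g)$. The group $\mathfrak{G}$ is the Shephard-Todd complex reflection group number $9$. *)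

(* Defs.v *)
From HB Require Import structures.
From mathcomp Require Import all_boot all_order all_algebra all_fingroup.
From mathcomp Require Import all_solvable all_field all_character.
From mathcomp Require Import complex boolp reals ring.

Set Implicit Arguments.
Unset Strict Implicit.
Unset Printing Implicit Defensive.

Import Order.TTheory GRing.Theory Num.Theory.
Local Open Scope ring_scope.

Definition mxrows (F : nmodType) (n : nat) (s : seq (seq F)) : 'M[F]_n :=
  \matrix_(i < n, j < n) nth 0 (nth [::] s i) j.

Section Group.
Variable R : realType.
Local Notation C := R[i].

Definition sqrt2 : C := (Num.sqrt 2)%:C%C.

Definition matT : 'M[C]_2 := sqrt2^-1 *: mxrows 2 [:: [:: 1; 1]; [:: 1; -1]].

Definition matD : 'M[C]_2 := mxrows 2 [:: [:: 1; 0]; [:: 0; 'i%C]].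

Inductive generated : 'M[C]_2 -> Prop :=
| generatedT : generated matT
| generatedD : generated matD
| generated1 : generated 1%:M
| generatedM A B : generated A -> generated B -> generated (A *m B)
| generatedV A : generated A -> generated (invmx A).

(* The matrix group itself, as a finGroupType whose product is *m. *)
Record frakG := FrakG { frakG_val :> 'M[C]_2; _ : `[< generated frakG_val >] }.

HB.instance Definition _ := [isSub for frakG_val].
HB.instance Definition _ := [Choice of frakG by <:].

Lemma frakG_gen (g : frakG) : generated (val g).
Proof. by case: g => A /= /asboolP. Qed.

Definition frakT : frakG := FrakG (asboolT generatedT).
Definition frakD : frakG := FrakG (asboolT generatedD).

(* Finiteness: the 48 vectors zeta8 ^+ b *: w, with w one of (1,0), (0,1) and
   (1, 'i ^+ k) / sqrt2, are permuted by the group and span the plane. *)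

Definition zeta8 : C := sqrt2^-1 * (1 + 'i%C).

Definition base_vec (k : nat) : 'cV[C]_2 :=
  \col_(j < 2) (if k is k'.+2 then sqrt2^-1 * 'i%C ^+ (k' * j)
                else (j == k :> nat)%:R).

Definition orbit48 : seq 'cV[C]_2 :=
  [seq zeta8 ^+ b *: base_vec k | b <- iota 0 8, k <- iota 0 6].

Lemma sqr_sqrt2V : sqrt2^-1 * sqrt2^-1 * 2 = 1.
Proof.
rewrite -invfM /sqrt2 -rmorphM /= -expr2 sqr_sqrtr ?ler0n // rmorph_nat.
by rewrite mulVf // pnatr_eq0.
Qed.

Lemma sqr_imag : 'i%C * 'i%C = -1 :> C.
Proof. by rewrite -expr2 sqr_i. Qed.

Lemma sqr_zeta8 : zeta8 * zeta8 = 'i%C.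
Proof.
rewrite /zeta8; move: sqr_sqrt2V sqr_imag.
by move: sqrt2^-1 ('i%C : C) => s i s2 i2; ring: s2 i2.
Qed.

Lemma zeta8_7 : zeta8 ^+ 7 = - 'i%C * zeta8.
Proof.
rewrite (exprD _ 6 1) (exprM _ 2 3) (expr2 zeta8) sqr_zeta8 expr1.
by rewrite (exprS 'i%C) (expr2 'i%C) sqr_imag mulrN1.
Qed.

Lemma zeta8_mod b : zeta8 ^+ b = zeta8 ^+ (b %% 8).
Proof.
have z8 : zeta8 ^+ 8 = 1.
  by rewrite (exprM _ 2 4) (expr2 zeta8) sqr_zeta8 (exprM _ 2 2) (expr2 'i%C)
    sqr_imag sqrrN expr1n.
by rewrite {1}(divn_eq b 8) exprD mulnC exprM z8 expr1n mul1r.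
Qed.

Lemma orbit48P b k : (k < 6)%N -> zeta8 ^+ b *: base_vec k \in orbit48.
Proof.
move=> k6; rewrite zeta8_mod; apply/allpairsP; exists (b %% 8, k)%N.
by rewrite !mem_iota /= !add0n ltn_mod k6.
Qed.

Definition tableT := [:: (0, 2); (0, 4); (0, 0); (1, 5); (0, 1); (7, 3)]%N.
Definition tableD := [:: (0, 0); (2, 1); (0, 3); (0, 4); (0, 5); (0, 2)]%N.

Lemma matT_base k : (k < 6)%N -> let: (b, l) := nth (0, 0)%N tableT k in
  matT *m base_vec k = zeta8 ^+ b *: base_vec l.
Proof.
move=> k6; have s2 := sqr_sqrt2V; have i2 := sqr_imag.
case: k k6 => [|[|[|[|[|[|//]]]]]] _ /=;
  apply/colP=> -[[|[|//]] lt_j2]; rewrite !mxE !big_ord_recl big_ord0 !mxE /=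
    ?zeta8_7 /zeta8; by ring: s2 i2.
Qed.

Lemma matD_base k : (k < 6)%N -> let: (b, l) := nth (0, 0)%N tableD k in
  matD *m base_vec k = zeta8 ^+ b *: base_vec l.
Proof.
move=> k6; have s2 := sqr_sqrt2V; have i2 := sqr_imag.
case: k k6 => [|[|[|[|[|[|//]]]]]] _ /=;
  apply/colP=> -[[|[|//]] lt_j2]; rewrite !mxE !big_ord_recl big_ord0 !mxE /=
    ?zeta8_7 /zeta8; by ring: s2 i2.
Qed.

Definition stable (A : 'M[C]_2) := {in orbit48, forall v, A *m v \in orbit48}.

Lemma stable_table A (t : seq (nat * nat)) :
    all (fun bl => bl.2 < 6)%N t -> size t = 6 ->
    (forall k, (k < 6)%N -> let: (b, l) := nth (0, 0)%N t k in
      A *m base_vec k = zeta8 ^+ b *: base_vec l) ->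
  stable A.
Proof.
move=> t6 szt tP _ /allpairsP [[b k] [_ + ->]]; rewrite mem_iota /= add0n => k6.
rewrite -scalemxAr; have := tP _ k6; have := all_nthP (0, 0)%N t6 k.
rewrite szt => /(_ k6); case: (nth _ _ _) => c l /= l6 ->.
by rewrite scalerA -exprD orbit48P.
Qed.

Lemma matT_unit : matT \in unitmx.
Proof.
suff TT : matT *m matT = 1%:M by case: (mulmx1_unit TT).
have s2 := sqr_sqrt2V.
by apply/matrixP=> -[[|[|//]] ?] -[[|[|//]] ?];
  rewrite !mxE !big_ord_recl big_ord0 !mxE /=; ring: s2.
Qed.

Lemma matD_unit : matD \in unitmx.
Proof.
suff DD : matD *m mxrows 2 [:: [:: 1; 0]; [:: 0; - 'i%C]] = 1%:M.
  by case: (mulmx1_unit DD).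
have i2 := sqr_imag.
by apply/matrixP=> -[[|[|//]] ?] -[[|[|//]] ?];
  rewrite !mxE !big_ord_recl big_ord0 !mxE /=; ring: i2.
Qed.

Lemma generated_unit A : generated A -> A \in unitmx.
Proof.
move=> genA; elim: genA => [||| B1 B2 _ U1 _ U2 | B _ UB].
- exact: matT_unit.
- exact: matD_unit.
- exact: unitmx1.
- by rewrite unitmx_mul U1.
- by rewrite unitmx_inv.
Qed.

Lemma generated_stable A : generated A -> stable A.
Proof.
move=> genA; elim: genA => [||| B1 B2 _ S1 _ S2 | B genB SB] v vO.
- exact: (@stable_table _ tableT _ _ matT_base).
- exact: (@stable_table _ tableD _ _ matD_base).
- by rewrite mul1mx.
- by rewrite -mulmxA S1 ?S2.
have uB := generated_unit genB; have injB : injective (mulmx B : 'cV_2 -> _).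
  by apply: can_inj (mulmx (invmx B)) _ => w; rewrite mulKmx.
have uniqB : uniq [seq B *m w | w <- undup orbit48].
  by rewrite map_inj_uniq ?undup_uniq.
have subB : {subset [seq B *m w | w <- undup orbit48] <= undup orbit48}.
  by move=> _ /mapP [w + ->]; rewrite !mem_undup; apply: SB.
have [|_ mapE] := uniq_min_size uniqB subB; first by rewrite size_map.
have /mapP [w wO ->] : v \in [seq B *m w | w <- undup orbit48].
  by rewrite mapE mem_undup.
by rewrite mulKmx // -mem_undup.
Qed.

(* An element is determined by its columns, which lie in orbit48. *)
Lemma frakG_col_proof (g : frakG) (j : 'I_2) : col j (val g) \in orbit48.
Proof.
have [l l6 ->] : exists2 l, (l < 6)%N & col j (val g) = val g *m base_vec l.
  exists (j : nat); first by apply: leq_trans (ltn_ord j) _.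
  rewrite colE; congr (_ *m _); apply/colP=> i; rewrite !mxE andbT.
  by case: j => -[|[|//]].
have := generated_stable (frakG_gen g) (orbit48P 0 l6).
by rewrite expr0 scale1r.
Qed.

Definition frakG_code (g : frakG) : {ffun 'I_2 -> seq_sub orbit48} :=
  [ffun j => SeqSub (frakG_col_proof g j)].

Lemma frakG_code_inj : injective frakG_code.
Proof.
move=> g h /ffunP eq_gh; apply/val_inj/matrixP=> i j.
by have /(congr1 val)/colP/(_ i) := eq_gh j; rewrite !ffunE !mxE.
Qed.

Definition frakG_decode c : option frakG :=
  if pselect (exists g, frakG_code g == c) is left ex_g then Some (xchoose ex_g)
  else None.

Lemma frakG_codeK : pcancel frakG_code frakG_decode.
Proof.
move=> g; rewrite /frakG_decode; case: pselect => [ex_g | []]; last by exists g.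
by congr Some; apply/frakG_code_inj/eqP/(xchooseP ex_g).
Qed.

HB.instance Definition _ := PCanIsCountable frakG_codeK.
HB.instance Definition _ : isFinite frakG := PCanIsFinite frakG_codeK.

Definition frakG_mul (g h : frakG) : frakG :=
  FrakG (asboolT (generatedM (frakG_gen g) (frakG_gen h))).
Definition frakG_one : frakG := FrakG (asboolT generated1).
Definition frakG_inv (g : frakG) : frakG :=
  FrakG (asboolT (generatedV (frakG_gen g))).

Lemma frakG_mulA : associative frakG_mul.
Proof. by move=> g h k; apply/val_inj/mulmxA. Qed.

Lemma frakG_mul1 : left_id frakG_one frakG_mul.
Proof. by move=> g; apply/val_inj/mul1mx. Qed.

Lemma frakG_mulV : left_inverse frakG_one frakG_inv frakG_mul.
Proof. by move=> g; apply/val_inj/mulVmx/generated_unit/frakG_gen. Qed.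

HB.instance Definition _ :=
  Finite_isGroup.Build frakG frakG_mulA frakG_mul1 frakG_mulV.

End Group.

Section Representations.
Variables (F : fieldType) (gT : finGroupType) (G : {group gT}).
Local Notation reprG := (representation F G).

(* Irreducibility is that of the action on row vectors, v |-> v *m rho g; a
   representation of degree 0 is not irreducible. *)
Definition complete_irreducibles (I : Type) (P : pred nat) (rho : I -> reprG) :=
  [/\ forall i, mx_irreducible (rho i) /\ P (rdegree (rho i)),
      forall i j, mx_rsim (rho i) (rho j) -> i = j &
      forall r : reprG, mx_irreducible r -> P (rdegree r) ->
        exists i, mx_rsim r (rho i)].

(* Up to equivalence, exactly m irreducible representations have a degree
   satisfying P. *)
Definition num_irreducibles (P : pred nat) (m : nat) : Prop :=
  exists rho : 'I_m -> reprG, complete_irreducibles P rho.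

End Representations.

(* Main.v *)
Require Import Defs.
From mathcomp Require Import all_boot all_order all_algebra all_fingroup.
From mathcomp Require Import all_solvable all_field all_character.
From mathcomp Require Import complex boolp reals ring zify.

Set Implicit Arguments.
Unset Strict Implicit.
Unset Printing Implicit Defensive.

Import Order.TTheory GRing.Theory Num.Theory.
Local Open Scope ring_scope.

(** The group is generated by T and D, so a representation of it could be built
    by checking relations; here the representations are instead read off from
    how the group transforms vectors of polynomials.  If m is a map from the
    plane to C^d with linearly independent components, and m (T v) = N_T m v,
    m (D v) = N_D m v for all v, then every g in the group has a unique matrix
    N_g with m (g v) = N_g m v, and g |-> N_g is a representation taking T to
    N_T and D to N_D ([cov_repr]).  The monomials of degree 1, 2, 3 give the
    symmetric powers of the defining representation, of degrees 2, 3, 4; one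
    more representation of degree 2 comes from the invariant span of x^4 + y^4
    and 2 x^2 y^2 inside the quartics; the linear characters come from products
    of powers of Klein's octahedral forms of degrees 6 and 12, which are
    semi-invariants ([vertex_form], [edge_form]).  Twists of these four
    representations by the characters give all the others.

    In each of these representations of degree above 1, D is diagonal with
    distinct eigenvalues and the first row and column of T have no zero entry,
    which forces irreducibility ([cyclic_diag_irr]); twisting by a linear
    character preserves it.  The traces of T, D and T D separate the 32 representations.

    Completeness and the order of the group are settled by counting.  The sum
    of the squares of the 32 degrees is 8 + 12 * 4 + 8 * 9 + 4 * 16 = 192, and
    for pairwise inequivalent irreducible representations over an algebraically
    closed field of characteristic 0 such a sum is at most the group order,
    with equality only if no irreducible representation is missing
    ([sum_sqr_rdegree_le], [complete_of_sum_sqr]).  Conversely an element is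
    determined by its first column, which is one of 48 vectors, and its
    determinant, which is a power of i; so the order is at most 48 * 4 = 192
    ([frakG_order_le]). *)

(** * Sums of squares of degrees *)

Section SumOfSquares.
Variables (F : closedFieldType) (gT : finGroupType) (G : {group gT}).
Hypothesis F'G : [pchar F]^'.-group%g G.
Variables (I : finType) (rho : I -> representation F G).
Hypothesis irr_rho : forall i, mx_irreducible (rho i).
Hypothesis rho_inj : forall i j, mx_rsim (rho i) (rho j) -> i = j.

Let sG : irrType F G := DecSocleType (regular_repr F G).
Let comp i : sG := irr_comp sG (rho i).

Let rsim_comp i : mx_rsim (rho i) (irr_repr (comp i)).
Proof. exact: rsim_irr_comp_pchar (irr_rho i). Qed.

Let comp_inj : injective comp.
Proof.
move=> i j eq_ij; apply/rho_inj/(mx_rsim_trans (rsim_comp i)).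
by rewrite eq_ij; apply/mx_rsim_sym/rsim_comp.
Qed.

Let sum_comp :
  (\sum_i rdegree (rho i) ^ 2 = \sum_(j in codom comp) irr_degree j ^ 2)%N.
Proof.
have uniq_comp : uniq (codom comp) by rewrite map_inj_uniq ?enum_uniq.
rewrite -(big_uniq _ uniq_comp) big_map big_enum /=.
by apply: eq_bigr => i _; case: (rsim_comp i) => B eq_deg _ _; rewrite eq_deg.
Qed.

(** Distinct members of the family lie in distinct Wedderburn components of the
    group algebra, and the squares of the degrees of all the components add up
    to the order of the group. *)
Lemma sum_sqr_rdegree_le : (\sum_i rdegree (rho i) ^ 2 <= #|G|)%N.
Proof.
rewrite sum_comp -(sum_irr_degree_pchar sG F'G) //.
  by rewrite [leqRHS](bigID (mem (codom comp))) leq_addr.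
by move=> n rG; apply: group_closure_closed_field.
Qed.

(** A missing irreducible representation would contribute a positive square to
    the sum over all components, on top of the squares of the family. *)
Lemma complete_of_sum_sqr :
  (#|G| <= \sum_i rdegree (rho i) ^ 2)%N -> complete_irreducibles predT rho.
Proof.
move=> leG; split=> [i | | r irr_r _]; [by [] | exact: rho_inj |].
suff /codomP [i def_i] : irr_comp sG r \in codom comp.
  exists i; apply: mx_rsim_trans (rsim_irr_comp_pchar sG F'G irr_r) _.
  by rewrite def_i; apply/mx_rsim_sym/rsim_comp.
apply: contraTT leG => r'comp; rewrite -ltnNge sum_comp.
rewrite -(sum_irr_degree_pchar sG F'G); last first.
  by move=> n rG; apply: group_closure_closed_field.
rewrite [ltnRHS](bigID (mem (codom comp))) /= -[ltnLHS]addn0 ltn_add2l.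
by rewrite (bigD1 (irr_comp sG r)) //= addn_gt0 expn_gt0 irr_degree_gt0.
Qed.

End SumOfSquares.

Section Restrict.
Variables (F : fieldType) (gT : finGroupType) (G : {group gT}).

Lemma complete_irreducibles_sub (I J : Type) (rho : I -> representation F G)
    (f : J -> I) (P : pred nat) :
    complete_irreducibles predT rho -> injective f ->
    (forall i, P (rdegree (rho i)) <-> exists j, i = f j) ->
  complete_irreducibles P (rho \o f).
Proof.
case=> irr_rho rho_inj rho_full f_inj fP; split=> [j | j k /rho_inj/f_inj //|].
  by split; [case: (irr_rho (f j)) | apply/fP; exists j].
move=> r irr_r Pr; have [i sim_ri] := rho_full r irr_r isT.
have deg_i : rdegree r = rdegree (rho i) by case: sim_ri => B.
have [j def_i] : exists j, i = f j by apply/fP; rewrite -deg_i.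
by exists j; rewrite /= -def_i.
Qed.

End Restrict.

(** * Twisting and irreducibility *)

Section Twist.
Variables (F : fieldType) (gT : finGroupType) (G : {group gT}) (n : nat).
Variables (chi : mx_representation F G 1) (rG : mx_representation F G n).

Definition twist_mx g := chi g 0 0 *: rG g.

Lemma twist_mx_repr : mx_repr G twist_mx.
Proof.
split=> [|g h Gg Gh]; rewrite /twist_mx.
  by rewrite !repr_mx1 mxE scale1r.
rewrite !repr_mxM // -scalemxAl -scalemxAr scalerA; congr (_ *: _).
by rewrite mxE big_ord1.
Qed.
Canonical twist_repr := MxRepresentation twist_mx_repr.

Lemma lin_repr_neq0 g : g \in G -> chi g 0 0 != 0.
Proof.
move=> Gg; have := repr_mx_unit chi Gg.
by rewrite unitmxE unitfE det_mx11.
Qed.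

(** Scaling the matrices by nonzero scalars leaves the invariant subspaces
    unchanged. *)
Lemma twist_irr : mx_irreducible rG -> mx_irreducible twist_repr.
Proof.
move/mx_irrP=> [n_gt0 irr_rG]; apply/mx_irrP; split=> // U /mxmoduleP modU.
apply: irr_rG; apply/mxmoduleP => g Gg; have := modU g Gg.
rewrite /= /twist_mx -scalemxAr.
by rewrite (eqmx_scale _ (lin_repr_neq0 Gg)).
Qed.

End Twist.

(** Applying polynomials in the diagonal matrix of g to a nonzero vector of an
    invariant subspace U yields a basis vector in U.  As column 0 of the matrix
    of h has no zero, the image of that vector has a nonzero coordinate 0, so U
    contains the basis vector number 0; as row 0 has no zero either, U then
    contains all the others. *)
Lemma cyclic_diag_irr (F : fieldType) (gT : finGroupType) (G : {group gT})
    (n : nat) (rG : mx_representation F G n.+1) (g h : gT)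
    (d : 'I_n.+1 -> F) :
    g \in G -> h \in G -> injective d ->
    (forall i j, rG g i j = d i *+ (i == j)) ->
    (forall i, rG h 0 i != 0 /\ rG h i 0 != 0) ->
  mx_irreducible rG.
Proof.
move=> Gg Gh d_inj rgE rhE; apply/mx_irrP; split=> // U /mxmoduleP modU nzU.
pose e i : 'rV[F]_n.+1 := delta_mx 0 i.
have coordP (v : 'rV_n.+1) i : (v <= U)%MS -> v 0 i != 0 -> (e i <= U)%MS.
  move=> vU nz_vi.
  (* Multiplying w by the matrix of g minus d k multiplies each coordinate j by
     d j - d k. *)
  have filtP (s : seq 'I_n.+1) : exists2 w : 'rV_n.+1,
      (w <= U)%MS & forall j, w 0 j = v 0 j * \prod_(k <- s) (d j - d k).
    elim: s => [|k s [w wU wE]].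
      by exists v => // j; rewrite big_nil mulr1.
    exists (w *m rG g - d k *: w) => [|j].
      rewrite addmx_sub ?eqmx_opp ?scalemx_sub //.
      exact: submx_trans (submxMr _ wU) (modU g Gg).
    rewrite big_cons !mxE (bigD1 j) //= big1 => [|l l'j]; last first.
      by rewrite rgE (negPf l'j) mulr0.
    by rewrite rgE eqxx addr0 mulr1n wE; ring.
  have [w wU wE] := filtP (rem i (enum 'I_n.+1)).
  have w_i j : (w 0 j != 0) = (j == i).
    rewrite wE mulf_eq0 prodf_seq_eq0 negb_or -all_predC.
    have [-> | i'j] := eqVneq j i.
      rewrite nz_vi /=; apply/allP => k; rewrite rem_filter ?enum_uniq //.
      by rewrite mem_filter /= subr_eq0 (inj_eq d_inj) eq_sym => /andP [].
    apply/negbTE; rewrite negb_and; apply/orP; right; apply/allPn; exists j.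
      by rewrite rem_filter ?enum_uniq // mem_filter /= i'j mem_enum.
    by rewrite /= subrr eqxx.
  have -> : e i = (w 0 i)^-1 *: w.
    apply/rowP=> j; rewrite !mxE eqxx /=; have := w_i j.
    case: (eqVneq j i) => [-> nz | _ /negbFE/eqP ->]; last by rewrite mulr0.
    by rewrite mulVf.
  exact: scalemx_sub.
have eh i : (e i <= U)%MS -> forall j, rG h i j != 0 -> (e j <= U)%MS.
  move=> eU j nz; apply: (coordP (e i *m rG h)).
    exact: submx_trans (submxMr _ eU) (modU h Gh).
  by rewrite -rowE mxE.
have e0U : (e 0 <= U)%MS.
  have [i nz_i] : exists i, nz_row U 0 i != 0.
    by apply/rV0Pn; rewrite nz_row_eq0.
  by apply: (eh i); [apply: coordP nz_i; apply: nz_row_sub | case: (rhE i)].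
rewrite -sub1mx; apply/row_subP=> i; rewrite row1.
by apply: eh e0U _ _; case: (rhE i).
Qed.

(** * The order of the group is at most 192 *)

Section Frak.
Variable R : realType.
Local Notation C := R[i].
Local Notation G := [set: frakG R]%G.
Local Notation T := (frakT R).
Local Notation D := (frakD R).
Local Notation s := (sqrt2 R)^-1.

(** Inverses need no case of their own: in a finite group they are powers. *)
Lemma frakG_ind (P : frakG R -> Prop) :
    P T -> P D -> P 1%g -> (forall g h, P g -> P h -> P (g * h)%g) ->
  forall g, P g.
Proof.
move=> PT PD P1 PM g.
suff {g} genP A : Defs.generated A -> forall g, val g = A -> P g.
  exact: genP (frakG_gen g) _ erefl.
elim=> {A} [||| A B genA IHA genB IHB | A genA IHA] g gE.
- by rewrite (_ : g = T) //; apply: val_inj.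
- by rewrite (_ : g = D) //; apply: val_inj.
- by rewrite (_ : g = 1%g) //; apply: val_inj.
- pose a := FrakG (asboolT genA); pose b := FrakG (asboolT genB).
  rewrite (_ : g = a * b)%g; last exact: val_inj.
  by apply: PM; [apply: IHA | apply: IHB].
- pose a := FrakG (asboolT genA).
  rewrite (_ : g = a^-1)%g; last exact: val_inj.
  rewrite invg_expg; elim: _.-1 => [|k IHk]; first by rewrite expg0.
  by rewrite expgS; apply: PM => //; apply: IHA.
Qed.

(** The k-th power of the matrix has k b in its corner, and g has finite order
    in characteristic 0. *)
Lemma frakG_unipotent (g : frakG R) b :
  val g = mxrows 2 [:: [:: 1; b]; [:: 0; 1]] -> g = 1%g.
Proof.
move=> gE.
have powE k : val (g ^+ k)%g = mxrows 2 [:: [:: 1; b *+ k]; [:: 0; 1]].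
  elim: k => [|k IHk].
    by apply/matrixP => -[[|[|//]] ?] -[[|[|//]] ?]; rewrite !mxE.
  rewrite expgS (_ : val _ = val g *m val (g ^+ k)%g) // IHk gE.
  apply/matrixP => -[[|[|//]] ?] -[[|[|//]] ?];
    rewrite !mxE !big_ord_recl big_ord0 !mxE /= ?mulrS; ring.
have b0 : b = 0.
  have := powE #[g]%g; rewrite expg_order => /matrixP/(_ 0 1).
  rewrite !mxE /= => /esym/eqP; rewrite mulrn_eq0.
  by rewrite -leqn0 leqNgt order_gt0 => /eqP.
apply: val_inj; rewrite gE b0.
by apply/matrixP => -[[|[|//]] ?] -[[|[|//]] ?]; rewrite !mxE.
Qed.

Lemma sqrt2_neq0 : sqrt2 R != 0.
Proof.
apply/eqP => r0; have := @sqr_sqrt2V R; rewrite r0 invr0 !mul0r => /eqP.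
by rewrite eq_sym oner_eq0.
Qed.

Lemma sqr_sqrt2 : sqrt2 R * sqrt2 R = 2.
Proof.
by rewrite -[LHS]mulr1 -[X in _ * X](@sqr_sqrt2V R); field; apply: sqrt2_neq0.
Qed.

Let i2 : 'i%C * 'i%C = -1 :> C := @sqr_imag R.

Lemma mxrows2E (A : 'M[C]_2) :
  A = mxrows 2 [:: [:: A 0 0; A 0 1]; [:: A 1 0; A 1 1]].
Proof.
by apply/matrixP => -[[|[|//]] ?] -[[|[|//]] ?]; rewrite !mxE /=;
  congr (A _ _); apply: val_inj.
Qed.

Lemma det_mxrows2 (a b c d : C) :
  \det (mxrows 2 [:: [:: a; b]; [:: c; d]]) = a * d - b * c.
Proof.
rewrite (expand_det_row _ ord0) !big_ord_recl big_ord0 /cofactor !det_mx11.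
by rewrite !mxE /= /bump /=; ring.
Qed.

Lemma det_frakG (g : frakG R) : \det (val g) \in [:: 1; 'i%C; -1; - 'i%C].
Proof.
elim/frakG_ind: g => [||| g h gP hP].
- have -> : \det (val T) = -1.
    by rewrite detZ det_mxrows2; field: sqr_sqrt2; rewrite sqrt2_neq0.
  by rewrite !inE eqxx !orbT.
- by rewrite det_mxrows2 !inE mul0r subr0 mul1r eqxx orbT.
- by rewrite det1 !inE eqxx.
rewrite (_ : val _ = val g *m val h) // det_mulmx; move: gP hP; rewrite !inE.
case/or4P=> /eqP -> /or4P [] /eqP ->;
  by rewrite ?(mulrNN, mulrN, mulNr, mul1r, mulr1, i2, opprK) eqxx ?orbT.
Qed.

(** If g and h have the same first column and the same determinant, then
    h^-1 * g fixes the first basis vector and has determinant 1, so it is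
    unipotent. *)
Lemma frakG_col_det_inj :
  injective (fun g : frakG R => (col 0 (val g), \det (val g))).
Proof.
move=> g h [/colP eq_col eq_det].
suff: (h^-1 * g)%g = 1%g by move/eqP; rewrite -eq_mulVg1 => /eqP.
have uh := generated_unit (frakG_gen h).
have kE : val (h^-1 * g)%g = invmx (val h) *m val g by [].
have k0 i : val (h^-1 * g)%g i 0 = (i == 0)%:R.
  rewrite kE; have /matrixP/(_ i 0) := mulVmx uh.
  rewrite !mxE => <-; apply: eq_bigr => j _; congr (_ * _).
  by have := eq_col j; rewrite !mxE.
have det_k1 : \det (val (h^-1 * g)%g) = 1.
  by rewrite kE det_mulmx eq_det -det_mulmx mulVmx ?det1.
apply: (@frakG_unipotent _ (val (h^-1 * g)%g 0 1)).
rewrite {1}[val _]mxrows2E !k0 /=; congr (mxrows 2 [:: _; [:: _; _]]).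
by move: det_k1; rewrite {1}[val _]mxrows2E det_mxrows2 !k0 mul1r mulr0 subr0.
Qed.

Lemma frakG_order_le : (#|G| <= 192)%N.
Proof.
rewrite cardE -(size_map (fun g : frakG R => (col 0 (val g), \det (val g)))).
apply: (@uniq_leq_size _ _ [seq (v, c) | v <- orbit48 R,
          c <- [:: 1; 'i%C; -1; - 'i%C] : seq C]).
  by rewrite map_inj_uniq ?enum_uniq //; apply: frakG_col_det_inj.
move=> _ /mapP [g _ ->]; apply/allpairsP; exists (col 0 (val g), \det (val g)).
by rewrite frakG_col_proof det_frakG.
Qed.

(** * Representations from covariant vectors of forms *)

Section Covariants.
Variables (d : nat) (m : 'cV[C]_2 -> 'cV[C]_d).

Definition covariant (A : 'M[C]_2) (N : 'M[C]_d) :=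
  forall v, m (A *m v) = N *m m v.

Definition independent :=
  forall c : 'rV[C]_d, (forall v, c *m m v = 0) -> c = 0.

(** Each row of N1 - N2 is a linear relation between the components of m. *)
Lemma covariant_uniq A N1 N2 :
  independent -> covariant A N1 -> covariant A N2 -> N1 = N2.
Proof.
move=> ind_m cov1 cov2; apply/eqP; rewrite -subr_eq0; apply/eqP/row_matrixP=> i.
rewrite row0; apply: ind_m => v.
by rewrite -row_mul mulmxBl -cov1 -cov2 subrr row0.
Qed.

Lemma covariant1 : covariant 1%:M 1%:M.
Proof. by move=> v; rewrite !mul1mx. Qed.

Lemma covariantM A B N1 N2 :
  covariant A N1 -> covariant B N2 -> covariant (A *m B) (N1 *m N2).
Proof. by move=> cov1 cov2 v; rewrite -!mulmxA cov1 cov2. Qed.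

Variables NT ND : 'M[C]_d.
Hypotheses (ind_m : independent).
Hypotheses (covT : covariant (matT R) NT) (covD : covariant (matD R) ND).

Lemma covariant_exists (g : frakG R) : exists N, covariant (val g) N.
Proof.
elim/frakG_ind: g => [||| g h [N1 cov1] [N2 cov2]].
- by exists NT.
- by exists ND.
- by exists 1%:M; apply: covariant1.
- by exists (N1 *m N2); apply: covariantM.
Qed.

(** The matrix is only known to exist, as its element may be any word in T and
    D; it is extracted by choice, and uniqueness makes it multiplicative. *)
Definition cov_mx (g : frakG R) := sval (cid (covariant_exists g)).

Lemma cov_mxP g : covariant (val g) (cov_mx g).
Proof. exact: svalP (cid (covariant_exists g)). Qed.

Lemma cov_mx_repr : mx_repr G cov_mx.
Proof.
split=> [|g h _ _]; apply: (covariant_uniq ind_m (cov_mxP _)).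
  exact: covariant1.
by apply: covariantM; apply: cov_mxP.
Qed.

Definition cov_repr := MxRepresentation cov_mx_repr.

Lemma cov_reprE (g : frakG R) N : covariant (val g) N -> cov_repr g = N.
Proof. exact: covariant_uniq ind_m (cov_mxP g). Qed.

Lemma cov_reprT : cov_repr T = NT.
Proof. by apply: cov_reprE; apply: covT. Qed.

Lemma cov_reprD : cov_repr D = ND.
Proof. by apply: cov_reprE; apply: covD. Qed.

End Covariants.

(** * The covariants *)

Lemma matT_act (v : 'cV[C]_2) :
  ((matT R *m v) 0 0 = (v 0 0 + v 1 0) / sqrt2 R) *
  ((matT R *m v) 1 0 = (v 0 0 - v 1 0) / sqrt2 R).
Proof.
have e : lift ord0 ord0 = 1 :> 'I_2 by apply: val_inj.
by split; rewrite mxE !big_ord_recl big_ord0 !mxE /= e; ring.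
Qed.

Lemma matD_act (v : 'cV[C]_2) :
  ((matD R *m v) 0 0 = v 0 0) * ((matD R *m v) 1 0 = 'i%C * v 1 0).
Proof.
have e : lift ord0 ord0 = 1 :> 'I_2 by apply: val_inj.
by split; rewrite mxE !big_ord_recl big_ord0 !mxE /= e; ring.
Qed.

Definition point (x y : C) : 'cV[C]_2 := \col_j (if j == 0 then x else y).

Definition monomials n (v : 'cV[C]_2) : 'cV[C]_n.+1 :=
  \col_(j < n.+1) (v 0 0 ^+ (n - j) * v 1 0 ^+ j).

(** On the points (1, t) a linear relation between the monomials becomes a
    polynomial of degree at most n in t, which vanishes identically. *)
Lemma monomials_independent n : independent (monomials n).
Proof.
move=> c c0; pose p := \poly_(j < n.+1) c 0 (inord j).
have p0 : p = 0.
  pose ks := [seq k%:R : C | k <- iota 0 n.+1].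
  apply: (@roots_geq_poly_eq0 _ p ks).
  - apply/allP => t _; rewrite /root horner_poly; apply/eqP.
    have /matrixP/(_ 0 0) := c0 (point 1 t); rewrite !mxE => {2}<-.
    apply: eq_bigr => j _.
    by rewrite !mxE /= expr1n mul1r inord_val.
  - rewrite map_inj_uniq ?iota_uniq //.
    by move=> j k /eqP; rewrite eqr_nat => /eqP.
  - by rewrite size_map size_iota size_poly.
apply/rowP=> j; have := coef_poly n.+1 (fun j => c 0 (inord j)) j.
by rewrite ltn_ord inord_val -/p p0 coef0 mxE.
Qed.

(** Klein's octahedral forms: on the Riemann sphere the zeros of the first are
    the vertices of an octahedron preserved by the group, those of the second
    the midpoints of its edges. *)
Definition vertex_form (v : 'cV[C]_2) : C :=
  v 0 0 * v 1 0 * (v 0 0 ^+ 4 - v 1 0 ^+ 4).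

Definition edge_form (v : 'cV[C]_2) : C :=
  v 0 0 ^+ 12 - 33 * v 0 0 ^+ 8 * v 1 0 ^+ 4
  - 33 * v 0 0 ^+ 4 * v 1 0 ^+ 8 + v 1 0 ^+ 12.

Lemma vertex_form_T v : vertex_form (matT R *m v) = vertex_form v.
Proof.
rewrite /vertex_form !matT_act.
move: (sqrt2 R) sqrt2_neq0 sqr_sqrt2 (v 0 0) (v 1 0) => r r0 r2 x y.
by field: r2.
Qed.

Lemma vertex_form_D v : vertex_form (matD R *m v) = 'i%C * vertex_form v.
Proof. by rewrite /vertex_form !matD_act; ring: i2. Qed.

Lemma edge_form_T v : edge_form (matT R *m v) = - edge_form v.
Proof.
rewrite /edge_form !matT_act.
move: (sqrt2 R) sqrt2_neq0 sqr_sqrt2 (v 0 0) (v 1 0) => r r0 r2 x y.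
by field: r2.
Qed.

Lemma edge_form_D v : edge_form (matD R *m v) = edge_form v.
Proof. by rewrite /edge_form !matD_act; ring: i2. Qed.

Section Linear.
Variables (a : bool) (b : nat).

(** The vertex form is fixed by T and multiplied by i under D, the edge form is
    negated by T and fixed by D, so products of powers reach every pair
    (1 or -1, a power of i). *)
Definition semi_invariant v : 'cV[C]_1 :=
  (edge_form v ^+ a * vertex_form v ^+ b)%:M.

(** Independence of a single form means that it has a nonzero value, which both
    octahedral forms have at (1, 2). *)
Lemma semi_invariant_independent : independent semi_invariant.
Proof.
move=> c /(_ (point 1 2)); rewrite /semi_invariant mul_mx_scalar => /eqP.
rewrite scaler_eq0 => /orP [|/eqP //]; rewrite mulf_eq0 => nz.
have edge_form0 : edge_form (point 1 2) != 0.
  rewrite (_ : edge_form _ = - 4879%:R) ?oppr_eq0 ?pnatr_eq0 //.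
  by rewrite /edge_form !mxE /=; ring.
have vertex_form0 : vertex_form (point 1 2) != 0.
  rewrite (_ : vertex_form _ = - 30%:R) ?oppr_eq0 ?pnatr_eq0 //.
  by rewrite /vertex_form !mxE /=; ring.
by case/orP: nz;
  rewrite expf_eq0 ?(negPf edge_form0) ?(negPf vertex_form0) andbF.
Qed.

Lemma semi_invariant_T : covariant semi_invariant (matT R) ((-1) ^+ a)%:M.
Proof.
move=> v; rewrite /semi_invariant edge_form_T vertex_form_T.
rewrite mul_scalar_mx scale_scalar_mx.
by rewrite (exprNn (edge_form v)) mulrA.
Qed.

Lemma semi_invariant_D : covariant semi_invariant (matD R) ('i%C ^+ b)%:M.
Proof.
move=> v; rewrite /semi_invariant edge_form_D vertex_form_D.
rewrite mul_scalar_mx scale_scalar_mx.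
by rewrite exprMn mulrCA.
Qed.

Definition lin_repr :=
  cov_repr semi_invariant_independent semi_invariant_T semi_invariant_D.

End Linear.

Ltac by_entries :=
  apply/colP=> -[[|[|[|[|//]]]] lt_j //];
  rewrite [LHS]mxE ?[in LHS]matT_act ?[in LHS]matD_act
    mxE !big_ord_recl big_ord0 !mxE /=.

Lemma monomials1 v : monomials 1 v = v.
Proof.
by apply/colP=> -[[|[|//]] lt_j]; rewrite mxE /= ?(mul1r, mulr1);
  congr (v _ _); apply: val_inj.
Qed.

Lemma monomials1_cov A : covariant (monomials 1) A A.
Proof. by move=> v; rewrite !monomials1. Qed.

Definition sym2T : 'M[C]_3 :=
  2^-1 *: mxrows 3 [:: [:: 1;  2;  1];
                       [:: 1;  0; -1];
                       [:: 1; -2;  1]].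

Definition sym2D : 'M[C]_3 :=
  mxrows 3 [:: [:: 1;    0;  0];
               [:: 0; 'i%C;  0];
               [:: 0;    0; -1]].

Lemma monomials2_T : covariant (monomials 2) (matT R) sym2T.
Proof.
move=> v; by_entries;
  by move: (sqrt2 R) sqrt2_neq0 sqr_sqrt2 (v 0 0) (v 1 0) =>
    r r0 r2 x y; field: r2.
Qed.

Lemma monomials2_D : covariant (monomials 2) (matD R) sym2D.
Proof. by move=> v; by_entries; ring: i2. Qed.

Definition sym3T : 'M[C]_4 :=
  (2 * sqrt2 R)^-1 *: mxrows 4 [:: [:: 1;  3;  3;  1];
                                   [:: 1;  1; -1; -1];
                                   [:: 1; -1; -1;  1];
                                   [:: 1; -3;  3; -1]].

Definition sym3D : 'M[C]_4 :=
  mxrows 4 [:: [:: 1;    0;  0;      0];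
               [:: 0; 'i%C;  0;      0];
               [:: 0;    0; -1;      0];
               [:: 0;    0;  0; - 'i%C]].

Lemma monomials3_T : covariant (monomials 3) (matT R) sym3T.
Proof.
move=> v; by_entries;
  by move: (sqrt2 R) sqrt2_neq0 sqr_sqrt2 (v 0 0) (v 1 0) =>
    r r0 r2 x y; field: r2.
Qed.

Lemma monomials3_D : covariant (monomials 3) (matD R) sym3D.
Proof. by move=> v; by_entries; ring: i2. Qed.

(** The factor 2 gives T the first row (1/2, 3/2); with x^2 y^2 itself it would
    be (1/2, 3). *)
Definition quartics (v : 'cV[C]_2) : 'cV[C]_2 :=
  \col_j (if j == 0 then v 0 0 ^+ 4 + v 1 0 ^+ 4
          else 2 * v 0 0 ^+ 2 * v 1 0 ^+ 2).

Definition quartT : 'M[C]_2 := 2^-1 *: mxrows 2 [:: [:: 1;  3]; [:: 1; -1]].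
Definition quartD : 'M[C]_2 := mxrows 2 [:: [:: 1;  0]; [:: 0; -1]].

Lemma quartics_independent : independent quartics.
Proof.
move=> c c0.
have e : lift ord0 ord0 = 1 :> 'I_2 by apply: val_inj.
have eqn x y : c 0 0 * (x ^+ 4 + y ^+ 4) + c 0 1 * (2 * x ^+ 2 * y ^+ 2) = 0.
  have /matrixP/(_ 0 0) := c0 (point x y).
  by rewrite mxE !big_ord_recl big_ord0 !mxE /= addr0 e.
have c00 : c 0 0 = 0 by rewrite -[RHS](eqn 1 0); ring.
have c01 : c 0 1 = 0.
  have /eqP := eqn 1 1; rewrite c00 mul0r add0r !expr1n !mulr1 mulf_eq0.
  by rewrite pnatr_eq0 orbF => /eqP.
apply/rowP => -[[|[|//]] lt_j]; rewrite mxE.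
  by rewrite -[RHS]c00; congr (c _ _); apply: val_inj.
by rewrite -[RHS]c01; congr (c _ _); apply: val_inj.
Qed.

Lemma quartics_T : covariant quartics (matT R) quartT.
Proof.
move=> v; by_entries;
  by move: (sqrt2 R) sqrt2_neq0 sqr_sqrt2 (v 0 0) (v 1 0) =>
    r r0 r2 x y; field: r2.
Qed.

Lemma quartics_D : covariant quartics (matD R) quartD.
Proof. by move=> v; by_entries; ring: i2. Qed.

(** * Irreducibility *)

Lemma imag_prim_root : 4.-primitive_root ('i%C : C).
Proof.
have i_sqr : 'i%C ^+ 2 = -1 :> C by rewrite expr2.
have neq1 : -1 != 1 :> C by rewrite -subr_eq0 -opprD oppr_eq0 -mulr2n pnatr_eq0.
have i4 : 'i%C ^+ 4 = 1 :> C by rewrite (exprM _ 2 2) i_sqr sqrrN expr1n.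
have [[|[|[|[|[|k]]]]] prim_k k4] := prim_order_exists (isT : 0 < 4)%N i4 => //.
- have i1 := prim_expr_order prim_k; rewrite expr1 in i1.
  by case/eqP: neq1; rewrite -i_sqr i1 expr1n.
- by case/eqP: neq1; rewrite -i_sqr (prim_expr_order prim_k).
Qed.

Lemma imag_expr_inj (j k : nat) :
  'i%C ^+ j = 'i%C ^+ k :> C -> (j = k %[mod 4])%N.
Proof. by move/eqP; rewrite (eq_prim_root_expr imag_prim_root) => /eqP. Qed.

Lemma imag_nth (j : nat) : (j < 4)%N ->
  'i%C ^+ j = [:: 1; 'i%C; -1; - 'i%C]`_j :> C.
Proof.
by case: j => [|[|[|[|//]]]] _ //=; rewrite ?exprS expr0 mulr1 ?i2 ?mulrN1.
Qed.

Definition std_repr := cov_repr (@monomials_independent 1)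
  (@monomials1_cov (matT R)) (@monomials1_cov (matD R)).
Definition quartic_repr := cov_repr quartics_independent quartics_T quartics_D.
Definition sym2_repr :=
  cov_repr (@monomials_independent 2) monomials2_T monomials2_D.
Definition sym3_repr :=
  cov_repr (@monomials_independent 3) monomials3_T monomials3_D.

Lemma lin_reprT a b : lin_repr a b T = ((-1) ^+ a)%:M.
Proof. exact: cov_reprT. Qed.

Lemma lin_reprD a b : lin_repr a b D = ('i%C ^+ b)%:M.
Proof. exact: cov_reprD. Qed.

Lemma lin_repr1 g : lin_repr false 0 g = 1%:M.
Proof.
by apply: cov_reprE => v; rewrite mul1mx /semi_invariant !expr0.
Qed.

Lemma std_reprE g : std_repr g = val g.
Proof. by apply: cov_reprE; apply: monomials1_cov. Qed.

Lemma quartic_reprT : quartic_repr T = quartT.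
Proof. exact: cov_reprT. Qed.

Lemma quartic_reprD : quartic_repr D = quartD.
Proof. exact: cov_reprD. Qed.

Lemma sym2_reprT : sym2_repr T = sym2T.
Proof. exact: cov_reprT. Qed.

Lemma sym2_reprD : sym2_repr D = sym2D.
Proof. exact: cov_reprD. Qed.

Lemma sym3_reprT : sym3_repr T = sym3T.
Proof. exact: cov_reprT. Qed.

Lemma sym3_reprD : sym3_repr D = sym3D.
Proof. exact: cov_reprD. Qed.

Lemma lin_repr_irr a b : mx_irreducible (lin_repr a b).
Proof.
apply: (@cyclic_diag_irr _ _ _ _ _ 1%g 1%g (fun=> 1)); rewrite ?inE //.
- by move=> i j _; rewrite !ord1.
- by move=> i j; rewrite repr_mx1 mxE !ord1.
- by move=> i; rewrite !ord1 repr_mx1 mxE oner_eq0.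
Qed.

Lemma imag_diag_irr n (rG : mx_representation C G n.+1) (e : nat) :
    (forall i j : 'I_n.+1, rG D i j = 'i%C ^+ (e * i) *+ (i == j)) ->
    (e * n < 4)%N -> (0 < e)%N ->
    (forall i, rG T 0 i != 0 /\ rG T i 0 != 0) ->
  mx_irreducible rG.
Proof.
move=> rDE en4 e_gt0 rTE.
apply: (@cyclic_diag_irr _ _ _ _ _ D T (fun i => 'i%C ^+ (e * i)));
  rewrite ?inE // => i j /imag_expr_inj /eqP.
have lt4 (k : 'I_n.+1) : (e * k < 4)%N.
  by apply: leq_ltn_trans en4; rewrite leq_mul2l -ltnS ltn_ord orbT.
by rewrite !modn_small // eqn_mul2l eqn0Ngt e_gt0 => /eqP/val_inj.
Qed.

Lemma std_irr : mx_irreducible std_repr.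
Proof.
have s0 : s != 0 by rewrite invr_eq0 sqrt2_neq0.
apply: (@imag_diag_irr _ _ 1%N) => // [i j | i]; rewrite !std_reprE.
  by case: i j => -[|[|//]] ? -[[|[|//]] ?]; rewrite !mxE /= ?expr1.
by case: i => -[|[|//]] ?; rewrite !mxE /= ?mulr1 ?mulrN1 ?oppr_eq0.
Qed.

Lemma quartic_irr : mx_irreducible quartic_repr.
Proof.
apply: (@imag_diag_irr _ _ 2%N) => // [i j | i].
  rewrite quartic_reprD imag_nth; last by case: i => -[|[|//]].
  by case: i j => -[|[|//]] ? -[[|[|//]] ?]; rewrite !mxE /=.
rewrite quartic_reprT; case: i => -[|[|//]] ?; rewrite !mxE /=.
  by rewrite mulr1 invr_eq0 pnatr_eq0.
by rewrite mulr1 mulf_eq0 invr_eq0 !pnatr_eq0.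
Qed.

Lemma sym2_irr : mx_irreducible sym2_repr.
Proof.
apply: (@imag_diag_irr _ _ 1%N) => // [i j | i].
  rewrite sym2_reprD imag_nth mul1n; last by case: i => -[|[|[|//]]].
  by case: i j => -[|[|[|//]]] ? -[[|[|[|//]]] ?]; rewrite !mxE /=.
by rewrite sym2_reprT; case: i => -[|[|[|//]]] ?;
  rewrite !mxE /= ?mulr1 ?mulf_eq0 ?invr_eq0 ?pnatr_eq0.
Qed.

Lemma sym3_irr : mx_irreducible sym3_repr.
Proof.
have r0 : (2 * sqrt2 R)^-1 != 0 :> C.
  by rewrite invr_eq0 mulf_neq0 ?pnatr_eq0 ?sqrt2_neq0.
apply: (@imag_diag_irr _ _ 1%N) => // [i j | i].
  rewrite sym3_reprD imag_nth mul1n; last by case: i => -[|[|[|[|//]]]].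
  by case: i j => -[|[|[|[|//]]]] ? -[[|[|[|[|//]]]] ?]; rewrite !mxE /=.
by rewrite sym3_reprT; case: i => -[|[|[|[|//]]]] ?;
  rewrite !mxE /= ?mulr1 ?mulf_eq0 ?(negPf r0) ?pnatr_eq0.
Qed.

(** * Inequivalence *)

Section Traces.
Variables (n n' : nat).
Variables (rG : mx_representation C G n) (rG' : mx_representation C G n').

(** Equivalent representations have equal traces; the three cases T, D, T D
    below are enough to separate all the representations at hand. *)
Lemma twist_rsim_trace (chi chi' : mx_representation C G 1) g :
    mx_rsim (twist_repr chi rG) (twist_repr chi' rG') ->
  chi g 0 0 * \tr (rG g) = chi' g 0 0 * \tr (rG' g).
Proof.
move=> sim; have Gg : g \in [set: frakG R] by rewrite inE.
by have := mxtrace_rsim sim Gg; rewrite /= /twist_mx !mxtraceZ.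
Qed.

Variables (a a' : bool) (b b' : nat).
Hypothesis sim :
  mx_rsim (twist_repr (lin_repr a b) rG) (twist_repr (lin_repr a' b') rG').

Lemma twist_rsim_T : (-1) ^+ a * \tr (rG T) = (-1) ^+ a' * \tr (rG' T).
Proof. by have := twist_rsim_trace T sim; rewrite !lin_reprT !mxE. Qed.

Lemma twist_rsim_D : 'i%C ^+ b * \tr (rG D) = 'i%C ^+ b' * \tr (rG' D).
Proof. by have := twist_rsim_trace D sim; rewrite !lin_reprD !mxE. Qed.

Lemma twist_rsim_TD :
  (-1) ^+ a * 'i%C ^+ b * \tr (rG T *m rG D) =
  (-1) ^+ a' * 'i%C ^+ b' * \tr (rG' T *m rG' D).
Proof.
have := twist_rsim_trace (T * D)%g sim.
have linTD x y : lin_repr x y (T * D)%g 0 0 = (-1) ^+ x * 'i%C ^+ y.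
  by rewrite repr_mxM ?inE // lin_reprT lin_reprD mul_scalar_mx !mxE.
by rewrite !linTD !repr_mxM ?inE.
Qed.

End Traces.

Lemma imag_neq0 : 'i%C != 0 :> C.
Proof.
by apply/eqP => i0; move/eqP: i2; rewrite i0 mul0r eq_sym oppr_eq0 oner_eq0.
Qed.

Lemma sign_imag_inj (a a' : bool) (b b' : nat) :
    'i%C ^+ b = 'i%C ^+ b' :> C ->
    (-1) ^+ a * 'i%C ^+ b = (-1) ^+ a' * 'i%C ^+ b' :> C ->
  a = a'.
Proof.
move=> ->; have nz : 'i%C ^+ b' != 0 :> C.
  exact/expf_neq0/imag_neq0.
by move/(mulIf nz)/signr_inj.
Qed.

Lemma imag_add_sub_neq0 : (1 + 'i%C != 0 :> C) /\ (1 - 'i%C != 0 :> C).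
Proof.
have nz : (1 + 'i%C) * (1 - 'i%C) != 0 :> C.
  rewrite (_ : _ * _ = 2); last by ring: i2.
  by rewrite pnatr_eq0.
by move: nz; rewrite mulf_eq0 negb_or => /andP.
Qed.

Lemma std_trD : \tr (std_repr D) = 1 + 'i%C.
Proof. by rewrite std_reprE /mxtrace !big_ord_recl big_ord0 !mxE /= addr0. Qed.

Lemma quartic_trD : \tr (quartic_repr D) = 0.
Proof.
by rewrite quartic_reprD /mxtrace !big_ord_recl big_ord0 !mxE /= addr0 subrr.
Qed.

Lemma sym2_trT : \tr (sym2_repr T) = 1.
Proof.
by rewrite sym2_reprT /mxtrace !big_ord_recl big_ord0 !mxE /=; field.
Qed.

Lemma sym2_trD : \tr (sym2_repr D) = 'i%C.
Proof.
by rewrite sym2_reprD /mxtrace !big_ord_recl big_ord0 !mxE /=; ring.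
Qed.

Lemma std_trTD : \tr (std_repr T *m std_repr D) = s * (1 - 'i%C).
Proof.
rewrite !std_reprE /mxtrace !big_ord_recl big_ord0 !mxE.
by rewrite !big_ord_recl !big_ord0 !mxE /=; ring.
Qed.

Lemma quartic_trTD : \tr (quartic_repr T *m quartic_repr D) = 1.
Proof.
rewrite quartic_reprT quartic_reprD /mxtrace !big_ord_recl big_ord0 !mxE.
by rewrite !big_ord_recl !big_ord0 !mxE /=; field.
Qed.

Lemma sym3_trTD : \tr (sym3_repr T *m sym3_repr D) = s * (1 + 'i%C).
Proof.
rewrite sym3_reprT sym3_reprD /mxtrace !big_ord_recl big_ord0 !mxE.
rewrite !big_ord_recl !big_ord0 !mxE /=.
by move: (sqrt2 R) sqrt2_neq0 => r r0; field.
Qed.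

(** * The thirty-two representations *)

(** The exponents of -1 and i in the images of T and D; the images of D are
    listed in the order 1, -1, i, -i, whence the exponents 0, 2, 1, 3. *)
Definition rho1_exps (k : nat) : bool * nat :=
  ((4 <= k)%N, nth 0%N [:: 0; 2; 1; 3]%N (k %% 4)).

Lemma rho1_exps_inj (j k : nat) : (j < 8)%N -> (k < 8)%N ->
    (rho1_exps j).1 = (rho1_exps k).1 ->
    (rho1_exps j).2 = (rho1_exps k).2 %[mod 4] -> j = k.
Proof.
by case: j => [|[|[|[|[|[|[|[|//]]]]]]]] _;
  case: k => [|[|[|[|[|[|[|[|//]]]]]]]].
Qed.

Definition rho1 (j : nat) :=
  lin_repr (rho1_exps j.-1).1 (rho1_exps j.-1).2.

Definition rho2 (j : nat) : mx_representation C G 2 :=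
  if (j <= 16)%N then twist_repr (lin_repr (4 <= j - 9)%N (j - 9)) std_repr
  else twist_repr (rho1 (j - 16)) quartic_repr.

Definition rho3 (j : nat) := twist_repr (rho1 (j - 20)) sym2_repr.

Definition rho4 (j : nat) := twist_repr (rho1 (j - 28)) sym3_repr.

Definition rho (j : nat) : representation C G :=
  if (j <= 8)%N then Representation (rho1 j)
  else if (j <= 20)%N then Representation (rho2 j)
  else if (j <= 28)%N then Representation (rho3 j)
  else Representation (rho4 j).

Lemma rho_irr j : mx_irreducible (rho j).
Proof.
rewrite /rho; case: ifP => _; first exact: lin_repr_irr.
case: ifP => _.
  rewrite /= /rho2; case: ifP => _; apply: twist_irr.
    exact: std_irr.
  exact: quartic_irr.
by case: ifP => _; apply: twist_irr; [apply: sym2_irr | apply: sym3_irr].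
Qed.

Lemma rho1_inj j k : (0 < j <= 8)%N -> (0 < k <= 8)%N ->
  mx_rsim (rho1 j) (rho1 k) -> j = k.
Proof.
case: j k => [//|j] [//|k] /= j8 k8 sim; congr _.+1.
have Gg g : g \in [set: frakG R] by rewrite inE.
apply: rho1_exps_inj => //.
  have := mxtrace_rsim sim (Gg T); rewrite !lin_reprT !mxtrace_scalar.
  exact: signr_inj.
apply: imag_expr_inj.
by have := mxtrace_rsim sim (Gg D); rewrite !lin_reprD !mxtrace_scalar.
Qed.

(** The trace of D, a nonzero multiple of a power of i, gives the twist of D;
    the trace of T D, which is also nonzero, then gives that of T. *)
Lemma std_twist_inj j k : (j < 8)%N -> (k < 8)%N ->
    mx_rsim (twist_repr (lin_repr (4 <= j)%N j) std_repr)
            (twist_repr (lin_repr (4 <= k)%N k) std_repr) ->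
  j = k.
Proof.
move=> j8 k8 sim; have [nzD nzTD] := imag_add_sub_neq0.
have eqD : 'i%C ^+ j = 'i%C ^+ k :> C.
  by apply: (mulIf nzD); have := twist_rsim_D sim; rewrite std_trD.
have nz : s * (1 - 'i%C) != 0 by rewrite mulf_neq0 ?invr_eq0 ?sqrt2_neq0.
have eqTD := twist_rsim_TD sim; rewrite std_trTD in eqTD.
have := sign_imag_inj eqD (mulIf nz eqTD).
have := imag_expr_inj eqD.
by case: j k j8 k8 {sim eqD eqTD} =>
  [|[|[|[|[|[|[|[|//]]]]]]]] [|[|[|[|[|[|[|[|//]]]]]]]].
Qed.

(** D has trace 0 in the quartic representation and all its twists, but not in
    those of the defining one. *)
Lemma std_quartic_not_sim a a' b b' :
  ~ mx_rsim (twist_repr (lin_repr a b) std_repr)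
            (twist_repr (lin_repr a' b') quartic_repr).
Proof.
move=> sim; have [nzD _] := imag_add_sub_neq0.
have := twist_rsim_D sim; rewrite std_trD quartic_trD mulr0 => /eqP.
by rewrite mulf_eq0 (negPf nzD) orbF expf_eq0 (negPf imag_neq0) andbF.
Qed.

(** The first four characters are trivial on T, so the trace of T D is enough to
    separate the four twists by them.  It has to be: in the quartic
    representation and in the symmetric cube both T and D have trace 0. *)
Lemma rho1_TD_twist_inj n (rG : mx_representation C G n) j k :
    (0 < j <= 4)%N -> (0 < k <= 4)%N -> \tr (rG T *m rG D) != 0 ->
    mx_rsim (twist_repr (rho1 j) rG) (twist_repr (rho1 k) rG) ->
  j = k.
Proof.
case: j k => [//|j] [//|k] /= j4 k4 nz sim; congr _.+1.
have pos (l : nat) : (l < 4)%N -> (4 <= l)%N = false.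
  by rewrite ltnNge => /negPf.
have := mulIf nz (twist_rsim_TD sim); rewrite /= !pos // !mul1r.
move/imag_expr_inj => eq_b.
by apply: rho1_exps_inj; [lia | lia | rewrite /= !pos | exact: eq_b].
Qed.

Lemma sym2_twist_inj j k : (0 < j <= 8)%N -> (0 < k <= 8)%N ->
    mx_rsim (twist_repr (rho1 j) sym2_repr) (twist_repr (rho1 k) sym2_repr) ->
  j = k.
Proof.
case: j k => [//|j] [//|k] /= j8 k8 sim; congr _.+1.
apply: rho1_exps_inj => //.
  by have := twist_rsim_T sim; rewrite sym2_trT !mulr1 => /signr_inj.
apply: imag_expr_inj; apply: (mulIf imag_neq0).
by have := twist_rsim_D sim; rewrite sym2_trD.
Qed.

Lemma rho2_inj j k : (8 < j <= 20)%N -> (8 < k <= 20)%N ->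
  mx_rsim (rho2 j) (rho2 k) -> j = k.
Proof.
move=> /andP [j8 j20] /andP [k8 k20]; rewrite /rho2.
case: (leqP j 16) => j16; case: (leqP k 16) => k16 sim.
- have : (j - 9 = k - 9)%N by apply: (std_twist_inj _ _ sim); lia.
  lia.
- by case: (std_quartic_not_sim sim).
- by case: (std_quartic_not_sim (mx_rsim_sym sim)).
have nz : \tr (quartic_repr T *m quartic_repr D) != 0.
  by rewrite quartic_trTD oner_eq0.
have : (j - 16 = k - 16)%N by apply: (rho1_TD_twist_inj _ _ nz sim); lia.
lia.
Qed.

Lemma rho3_inj j k : (20 < j <= 28)%N -> (20 < k <= 28)%N ->
  mx_rsim (rho3 j) (rho3 k) -> j = k.
Proof.
move=> /andP [j20 j28] /andP [k20 k28] sim.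
have : (j - 20 = k - 20)%N by apply: (sym2_twist_inj _ _ sim); lia.
lia.
Qed.

Lemma rho4_inj j k : (28 < j <= 32)%N -> (28 < k <= 32)%N ->
  mx_rsim (rho4 j) (rho4 k) -> j = k.
Proof.
move=> /andP [j28 j32] /andP [k28 k32] sim.
have nz : \tr (sym3_repr T *m sym3_repr D) != 0.
  have [nzD _] := imag_add_sub_neq0.
  by rewrite sym3_trTD mulf_neq0 ?invr_eq0 ?sqrt2_neq0.
have : (j - 28 = k - 28)%N by apply: (rho1_TD_twist_inj _ _ nz sim); lia.
lia.
Qed.

Definition degree (j : nat) : nat :=
  if (j <= 8)%N then 1
  else if (j <= 20)%N then 2 else if (j <= 28)%N then 3 else 4.

Lemma rdegree_rho j : rdegree (rho j) = degree j.
Proof. by rewrite /rho /degree; do 3![case: ifP => // _]. Qed.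

Lemma rho_inj j k : (0 < j <= 32)%N -> (0 < k <= 32)%N ->
  mx_rsim (rho j) (rho k) -> j = k.
Proof.
move=> /andP [j0 j32] /andP [k0 k32] sim.
have: degree j = degree k by rewrite -!rdegree_rho; case: sim.
rewrite /degree => eq_deg.
have [e8 e20 e28] : [/\ (j <= 8) = (k <= 8), (j <= 20) = (k <= 20) &
                        (j <= 28) = (k <= 28)]%N.
  by move: eq_deg; case: (leqP j 8); case: (leqP j 20); case: (leqP j 28);
    case: (leqP k 8); case: (leqP k 20); case: (leqP k 28) => *; split; lia.
move: sim; rewrite /rho -e8 -e20 -e28.
case: (leqP j 8) e8 => ? e8.
  by move=> sim; apply: (rho1_inj _ _ sim); lia.
case: (leqP j 20) e20 => ? e20.
  by move=> sim; apply: (rho2_inj _ _ sim); lia.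
case: (leqP j 28) e28 => ? e28 sim; first by apply: (rho3_inj _ _ sim); lia.
by apply: (rho4_inj _ _ sim); lia.
Qed.

Lemma sum_sqr_rdegree_rho : (\sum_(k < 32) rdegree (rho k.+1) ^ 2 = 192)%N.
Proof.
under eq_bigr => k _ do rewrite rdegree_rho.
by rewrite -(big_mkord xpredT (fun k => degree k.+1 ^ 2)%N) unlock.
Qed.

Lemma pchar'_frakG : [pchar C]^'.-group%g [set: frakG R].
Proof. by apply/pgroupP=> p _; rewrite inE /= pchar_num. Qed.

Lemma rho_ord_inj (i j : 'I_32) :
  mx_rsim (rho i.+1) (rho j.+1) -> i = j.
Proof.
by move/rho_inj => eq_ij; apply/val_inj/succn_inj/eq_ij; rewrite ltn_ord.
Qed.

(** * Counting and completeness *)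

(** The upper bound is [frakG_order_le]; the lower bound is the existence of
    inequivalent irreducible representations whose squared degrees sum
    to 192. *)
Lemma frakG_order : #|G| = 192%N.
Proof.
apply/eqP; rewrite eqn_leq frakG_order_le -sum_sqr_rdegree_rho.
apply: (sum_sqr_rdegree_le pchar'_frakG) => [i | i j]; first exact: rho_irr.
exact: rho_ord_inj.
Qed.

Lemma rho_complete :
  complete_irreducibles predT (fun k : 'I_32 => rho k.+1).
Proof.
apply: (complete_of_sum_sqr pchar'_frakG) => [i | i j |].
- exact: rho_irr.
- exact: rho_ord_inj.
by rewrite sum_sqr_rdegree_rho frakG_order.
Qed.

(** The representations of a given degree are consecutive in the numbering, so
    they form a complete subfamily of it. *)
Lemma num_irreducibles_block d off m : (off + m <= 32)%N ->
    (forall k, (k < 32)%N -> (degree k.+1 == d) = (off <= k < off + m)%N) ->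
  num_irreducibles C G (pred1 d) m.
Proof.
move=> le32 blockP.
have lt32 (j : 'I_m) : (off + j < 32)%N.
  by apply: leq_trans le32; rewrite ltn_add2l.
exists ((fun k : 'I_32 => rho k.+1) \o (fun j => Ordinal (lt32 j))).
apply: (complete_irreducibles_sub rho_complete)
  => [j k [/addnI/val_inj //] | i].
rewrite rdegree_rho /= blockP //; split=> [/andP [le_i lt_i] | [j ->] /=].
  have ltm : (i - off < m)%N by rewrite ltn_subLR.
  by exists (Ordinal ltm); apply: val_inj; rewrite /= subnKC.
by rewrite leq_addr ltn_add2l ltn_ord.
Qed.

End Frak.

Theorem mainTheorem1 (R : realType) :
  let G := [set: frakG R]%G in
  let T := frakT R in
  let D := frakD R in
  let i : R[i] := 'i%C in
  let s2 : R[i] := sqrt2 R in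
  #|G| = 192%N /\
  [/\ num_irreducibles R[i] G predT 32,
      num_irreducibles R[i] G (pred1 1%N) 8,
      num_irreducibles R[i] G (pred1 2%N) 12,
      num_irreducibles R[i] G (pred1 3%N) 8 &
      num_irreducibles R[i] G (pred1 4%N) 4] /\
  (* rho1, rho2, rho3, rho4 are the families of dimension 1, 2, 3, 4, indexed by
     1 <= j <= 8, 9 <= j <= 20, 21 <= j <= 28 and 29 <= j <= 32 respectively. *)
  exists (rho1 : nat -> mx_representation R[i] G 1)
         (rho2 : nat -> mx_representation R[i] G 2)
         (rho3 : nat -> mx_representation R[i] G 3)
         (rho4 : nat -> mx_representation R[i] G 4),
  [/\ forall k, (k < 8)%N ->
        let: (a, b) := nth (0, 0) [:: (1, 1); (1, -1); (1, i); (1, -i);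
                                   (-1, 1); (-1, -1); (-1, i); (-1, -i)] k in
        rho1 (1 + k)%N T = a%:M /\ rho1 (1 + k)%N D = b%:M,
      forall k, (k < 8)%N ->
        let: (e, h) := nth (0, 0) [:: (1, 1); (1, i); (1, -1); (1, -i);
                                   (-1, 1); (-1, i); (-1, -1); (-1, -i)] k in
        rho2 (9 + k)%N T = e *: matT R /\ rho2 (9 + k)%N D = h *: matD R,
      [/\ rho2 17%N T = 2^-1 *: mxrows 2 [:: [:: 1;  3];
                                           [:: 1; -1]],
          rho2 17%N D = mxrows 2 [:: [:: 1;  0];
                                   [:: 0; -1]] &
          forall k g, (1 <= k <= 3)%N ->
            rho2 (17 + k)%N g = rho1 k.+1 g 0 0 *: rho2 17%N g],
      [/\ rho3 21%N T = 2^-1 *: mxrows 3 [:: [:: 1;  2;  1];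
                                           [:: 1;  0; -1];
                                           [:: 1; -2;  1]],
          rho3 21%N D = mxrows 3 [:: [:: 1; 0;  0];
                                   [:: 0; i;  0];
                                   [:: 0; 0; -1]] &
          forall k g, (1 <= k <= 7)%N ->
            rho3 (21 + k)%N g = rho1 k.+1 g 0 0 *: rho3 21%N g] &
      [/\ rho4 29%N T = (2 * s2)^-1 *: mxrows 4 [:: [:: 1;  3;  3;  1];
                                                  [:: 1;  1; -1; -1];
                                                  [:: 1; -1; -1;  1];
                                                  [:: 1; -3;  3; -1]],
          rho4 29%N D = mxrows 4 [:: [:: 1; 0;  0;  0];
                                   [:: 0; i;  0;  0];
                                   [:: 0; 0; -1;  0];
                                   [:: 0; 0;  0; -i]] &
          forall k g, (1 <= k <= 3)%N ->
            rho4 (29 + k)%N g = rho1 k.+1 g 0 0 *: rho4 29%N g]]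
  /\ complete_irreducibles predT (fun k : 'I_32 =>
       let j := k.+1 in
       if (j <= 8)%N then Representation (rho1 j)
       else if (j <= 20)%N then Representation (rho2 j)
       else if (j <= 28)%N then Representation (rho3 j)
       else Representation (rho4 j)).
Proof.
move=> G T D i s2.
have imag4 : i ^+ 4 = 1 := prim_expr_order (imag_prim_root R).
split; first exact: frakG_order.
split.
  split.
  - by exists (fun k : 'I_32 => rho R k.+1); apply: rho_complete.
  - by apply: (@num_irreducibles_block R 1%N 0%N 8%N) => // k k32;
      rewrite /degree; case: (leqP k.+1 8); case: (leqP k.+1 20);
      case: (leqP k.+1 28) => *; lia.
  - by apply: (@num_irreducibles_block R 2%N 8%N 12%N) => // k k32;
      rewrite /degree; case: (leqP k.+1 8); case: (leqP k.+1 20);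
      case: (leqP k.+1 28) => *; lia.
  - by apply: (@num_irreducibles_block R 3%N 20%N 8%N) => // k k32;
      rewrite /degree; case: (leqP k.+1 8); case: (leqP k.+1 20);
      case: (leqP k.+1 28) => *; lia.
  - by apply: (@num_irreducibles_block R 4%N 28%N 4%N) => // k k32;
      rewrite /degree; case: (leqP k.+1 8); case: (leqP k.+1 20);
      case: (leqP k.+1 28) => *; lia.
exists (@rho1 R), (@rho2 R), (@rho3 R), (@rho4 R).
split; last exact: rho_complete.
have rho1_1 g : rho1 R 1 g 0 0 = 1 by rewrite lin_repr1 mxE.
split.
- move=> k k8; rewrite /rho1 lin_reprT lin_reprD add1n /=.
  by case: k k8 => [|[|[|[|[|[|[|[|//]]]]]]]] _ /=;
    rewrite imag_nth.
- move=> k k8; rewrite /rho2 ifT; last by lia.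
  rewrite /= /twist_mx addKn !std_reprE lin_reprT lin_reprD !mxE /= !mulr1n.
  by case: k k8 => [|[|[|[|[|[|[|[|//]]]]]]]] _ /=;
    rewrite -(expr_mod _ imag4) imag_nth.
- have rho2_17 g : rho2 R 17 g = quartic_repr R g.
    by rewrite /= /twist_mx rho1_1 scale1r.
  split=> [||k g /andP [k1 _]].
  + by rewrite rho2_17 quartic_reprT.
  + by rewrite rho2_17 quartic_reprD.
  rewrite rho2_17 /rho2 (_ : (17 + k <= 16)%N = false); last by lia.
  by rewrite (_ : (17 + k - 16) = k.+1)%N; last by lia.
- have rho3_21 g : rho3 R 21 g = sym2_repr R g.
    by rewrite /= /twist_mx rho1_1 scale1r.
  split=> [||k g /andP [k1 _]].
  + by rewrite rho3_21 sym2_reprT.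
  + by rewrite rho3_21 sym2_reprD.
  by rewrite rho3_21 /rho3 (_ : (21 + k - 20) = k.+1)%N; last by lia.
have rho4_29 g : rho4 R 29 g = sym3_repr R g.
  by rewrite /= /twist_mx rho1_1 scale1r.
split=> [||k g /andP [k1 _]].
+ by rewrite rho4_29 sym3_reprT.
+ by rewrite rho4_29 sym3_reprD.
by rewrite rho4_29 /rho4 (_ : (29 + k - 28) = k.+1)%N; last by lia.
Qed.
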